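(* For every instance $\pi$ of the fully labeled one-dimensional rearrangement problem (LOR), the algorithm OptPlanLOR computes a valid rearrangement plan that has minimum end-effector travel among all valid plans for $\pi$ that use the minimum possible number of pick-n-swaps.
   Context: Setting (LOR). A row of $m$ cells $1,\dots,m$, cell $i$ located at the point $i$ on the real line. Each cell initially holds exactly one item; items carry distinct labels $1,\dots,m$. An instance is a permutation $\pi$ of $\{1,\dots,m\}$, where $\pi_i$ is the label of the item initially in cell $i$; the goal is that item $i$ ends in cell $i$. A robot end-effector can hold at most one item; it starts at cell $1$ holding nothing. A pick-n-swap operation at a cell $p$: if holding nothing, pick up the item in $p$; if holding an item and $p$ contains an item, exchange the two; if holding an item and $p$ is empty, put the held item into $p$. A plan is a sequence $P=(p_0,p_1,\dots,p_N)$ of cells ($p_0=$ cell $1$) visited in order with a pick-n-swap at each of $p_1,\dots,p_N$, followed by a return to $p_{N+1}:=p_0$; it is valid if at the end every item $i$ is in cell $i$ and the end-effector holds nothing. $N$ is its number of pick-n-swaps and $\sum_{i=0}^N|p_i-p_{i+1}|$ its end-effector travel. Cycles: the non-trivial cycles (length $\ge 2$) of $\pi$, where cell $i$ points to cell $\pi_i$ (the goal of the item in cell $i$). For a cycle $c$ let $\min(c),\max(c)$ be its smallest and largest cell; for a set $C$ of cycles, $\min(C)=\min_{c\in C}\min(c)$, $\max(C)=\max_{c\in C}\max(c)$. Cycle groups: start with each cycle as a singleton group and repeatedly replace two groups whose intervals $[\min,\max]$ intersect by their union, until the groups' intervals are pairwise disjoint. OptPlanLOR: process the leftmost group. Within a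 group $C=\{c_1,c_2,\dots\}$ with $\min(c_1)<\min(c_2)<\dots$, start following cycle $c_1$ from cell $\min(c_1)$ by cycle following (pick the item at the starting cell, repeatedly carry the held item to its goal cell and swap, and close the cycle by placing the last item in the starting cell). When, while following a cycle, the end-effector carrying an item would pass over $\min(c')$ for the next not-yet-started cycle $c'$ of the group, it switches: at cell $\min(c')$ it swaps the carried item into that cell (parking it) and follows $c'$ in the same manner (recursively applying the same switching rule); upon closing $c'$ at $\min(c')$ it picks the parked item back up and resumes the interrupted cycle. When the end-effector reaches $\max(C)$ and there is a group to the right of $C$, it pauses and processes the next group to the right in the same way (recursively), then returns to finish $C$. After all groups are processed the end-effector returns to cell $1$. *)

(* Defs.v *)
From mathcomp Require Import all_boot.
Set Implicit Arguments. Unset Strict Implicit. Unset Printing Implicit Defensive.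

(* Instances.  An instance of LOR with m cells is a sequence [pi] of size  *)
(* m that is a permutation of [1; ...; m]; cell i (1 <= i <= m) initially *)
(* holds the item labelled [pf pi i] = pi_i.                              *)

Definition pf (pi : seq nat) (i : nat) : nat := nth 0 pi i.-1.

Definition is_instance (pi : seq nat) : Prop := perm_eq pi (iota 1 (size pi)).

Record state := St { hold : option nat; cont : nat -> option nat }.

Definition upd (f : nat -> option nat) (p : nat) (v : option nat) :=
  fun q => if q == p then v else f q.

(* one pick-n-swap at cell p (picking at an empty cell with an empty
   end-effector is a no-op; such a case is not covered by the paper) *)
Definition pns (s : state) (p : nat) : state :=
  match hold s, cont s p with
  | None, Some y => St (Some y) (upd (cont s) p None)
  | None, None => s
  | Some x, Some y => St (Some y) (upd (cont s) p (Some x))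
  | Some x, None => St None (upd (cont s) p (Some x))
  end.

Definition init (pi : seq nat) : state :=
  St None (fun q => if (1 <= q <= size pi) then Some (pf pi q) else None).

(* A plan is the sequence (p_1, ..., p_N) of cells; p_0 = p_{N+1} = cell 1 *)
Definition run (pi : seq nat) (P : seq nat) : state := foldl pns (init pi) P.

Definition valid (pi : seq nat) (P : seq nat) : Prop :=
  all (fun p => 1 <= p <= size pi) P /\
  hold (run pi P) = None /\
  (forall i, 1 <= i <= size pi -> cont (run pi P) i = Some i).

Definition nswaps (P : seq nat) : nat := size P.

Definition dist (a b : nat) : nat := (a - b) + (b - a).

Definition travel (P : seq nat) : nat := sumn (pairmap dist 1 (rcons P 1)).

(* A non-trivial cycle is represented by its smallest cell.                *)

Definition orb (pi : seq nat) (i : nat) : seq nat := traject (pf pi) i (size pi).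
Definition cmin (pi : seq nat) (i : nat) : nat := foldr minn i (orb pi i).
Definition cmax (pi : seq nat) (i : nat) : nat := foldr maxn i (orb pi i).

Definition nontriv (pi : seq nat) (i : nat) : bool :=
  (1 <= i <= size pi) && (pf pi i != i).

Definition cyc_reps (pi : seq nat) : seq nat :=
  [seq i <- iota 1 (size pi) | nontriv pi i && (cmin pi i == i)].

(* a group is a list of cycle representatives *)
Definition gmin (pi : seq nat) (G : seq nat) : nat := foldr minn (head 0 G) G.
Definition gmax (pi : seq nat) (G : seq nat) : nat :=
  foldr maxn 0 [seq cmax pi c | c <- G].

Definition ginter (pi : seq nat) (G H : seq nat) : bool :=
  (gmin pi G <= gmax pi H) && (gmin pi H <= gmax pi G).

Fixpoint merge_into (pi : seq nat) (G : seq nat) (gs : seq (seq nat))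
  : option (seq (seq nat)) :=
  match gs with
  | [::] => None
  | H :: gs' => if ginter pi G H then Some ((G ++ H) :: gs')
                else omap (cons H) (merge_into pi G gs')
  end.

Fixpoint merge_step (pi : seq nat) (gs : seq (seq nat)) : option (seq (seq nat)) :=
  match gs with
  | [::] => None
  | G :: gs' => match merge_into pi G gs' with
                | Some r => Some r
                | None => omap (cons G) (merge_step pi gs')
                end
  end.

Fixpoint merge_iter (pi : seq nat) (n : nat) (gs : seq (seq nat)) : seq (seq nat) :=
  match n with
  | 0 => gs
  | n'.+1 => match merge_step pi gs with
             | Some gs' => merge_iter pi n' gs'
             | None => gs
             end
  end.

(* each merge decreases the number of groups, so |cycles| iterations suffice *)
Definition groups (pi : seq nat) : seq (seq nat) :=
  merge_iter pi (size (cyc_reps pi)) [seq [:: c] | c <- cyc_reps pi].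

Definition group_of (pi : seq nat) (i : nat) : seq nat :=
  nth [::] (groups pi) (find (fun G => gmin pi G <= i <= gmax pi G) (groups pi)).

Definition next_group (pi : seq nat) (G : seq nat) : option (seq nat) :=
  let R := [seq H <- groups pi | gmax pi G < gmin pi H] in
  if R is H0 :: _ then
    Some (nth [::] R (find (fun H => gmin pi H == foldr minn (gmin pi H0) [seq gmin pi K | K <- R]) R))
  else None.

Definition first_unstarted (G started : seq nat) : option nat :=
  ohead [seq c <- sort leq G | c \notin started].

Definition strictly_between (a c b : nat) : bool :=
  ((a < c) && (c < b)) || ((b < c) && (c < a)).

(* OptPlanLOR.  The end-effector always carries the held item towards its  *)
(* goal cell, except that (i) it switches to the next not-yet-started     *)
(* cycle of the current group whenever it would pass over that cycle's    *)
(* smallest cell, and (ii) right after its pick-n-swap at max(C) it goes  *)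
(* to the smallest cell of the next group to the right (if any).  Parked  *)
(* items are recovered automatically by pick-n-swap semantics.  With an   *)
(* empty end-effector it starts the leftmost not-yet-started cycle.       *)
(* [anext] returns the next pick-n-swap cell and the updated set of       *)
(* started cycles; [pos] is the cell of the last pick-n-swap.             *)

Definition anext (pi : seq nat) (pos : nat) (s : state) (started : seq nat)
  : option (nat * seq nat) :=
  match hold s with
  | None =>
      match first_unstarted (cyc_reps pi) started with
      | Some c => Some (c, c :: started)
      | None => None
      end
  | Some g =>
      let C := group_of pi pos in
      match (if nontriv pi pos && (pos == gmax pi C) then next_group pi C else None) with
      | Some H => Some (gmin pi H, gmin pi H :: started)
      | None =>
          match first_unstarted (group_of pi g) started with
          | Some c => if strictly_between pos c g then Some (c, c :: started)
                      else Some (g, started)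
          | None => Some (g, started)
          end
      end
  end.

Fixpoint arun (pi : seq nat) (fuel pos : nat) (s : state) (started : seq nat)
  : seq nat :=
  match fuel with
  | 0 => [::]
  | f.+1 => match anext pi pos s started with
            | None => [::]
            | Some (p, st') => p :: arun pi f p (pns s p) st'
            end
  end.

(* the plan computed by OptPlanLOR (the final return to cell 1 is implicit
   in [travel]); the fuel bound is far above the 3m/2 operations needed *)
Definition OptPlanLOR (pi : seq nat) : seq nat :=
  arun pi (4 * size pi + 1) 1 (init pi) [::].

(* Main.v *)
(* A pick-n-swap always exchanges the content of the end-effector with that of the
   cell. Number of swaps: a valid plan visits every misplaced cell, and the first
   visited cell of each cycle at least twice. Travel: each edge (k, k+1) is crossed
   rightwards at least as often as there are items whose path crosses it, and at
   least once if a cycle lies entirely to its right; a closed tour crosses every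
   edge equally often in both directions.
   OptPlanLOR meets both bounds. Its state is described by the route L that the
   end-effector would follow by pure cycle following; starting a cycle prepends that
   cycle to L, delivering an item removes the head of L. Cycles are started from left
   to right, each exactly once, and every move either carries an item towards its
   goal or crosses, once, a gap between two groups. *)
Require Import Defs.
From mathcomp Require Import all_boot zify.
Set Implicit Arguments. Unset Strict Implicit. Unset Printing Implicit Defensive.

(** * Folded minima and maxima; pick-n-swap as an exchange *)

Lemma foldr_minn_mem x s : foldr minn x s \in x :: s.
Proof.
elim: s => [|y s IH] /=; first by rewrite inE.
rewrite /minn; case: ifP => _; first by rewrite !inE eqxx orbT.
by move: IH; rewrite !inE => /orP[->|->]; rewrite ?orbT.
Qed.

Lemma foldr_minn_le x s y : y \in x :: s -> foldr minn x s <= y.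
Proof.
elim: s => [|z s IH] /=; first by rewrite inE => /eqP->.
rewrite !inE => /or3P[/eqP yx|/eqP->|ys].
- by rewrite geq_min IH ?orbT // yx inE eqxx.
- by rewrite geq_minl.
- by rewrite geq_min IH ?orbT // inE ys orbT.
Qed.

Lemma foldr_maxn_mem x s : foldr maxn x s \in x :: s.
Proof.
elim: s => [|y s IH] /=; first by rewrite inE.
rewrite /maxn; case: ifP => _; last by rewrite !inE eqxx orbT.
by move: IH; rewrite !inE => /orP[->|->]; rewrite ?orbT.
Qed.

Lemma foldr_maxn_ge x s y : y \in x :: s -> y <= foldr maxn x s.
Proof.
elim: s => [|z s IH] /=; first by rewrite inE => /eqP->.
rewrite !inE => /or3P[/eqP yx|/eqP->|ys].
- by rewrite leq_max IH ?orbT // yx inE eqxx.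
- by rewrite leq_maxl.
- by rewrite leq_max IH ?orbT // inE ys orbT.
Qed.

Lemma hold_pns s p : hold (pns s p) = cont s p.
Proof. by rewrite /pns; case: s => [[x|] f] /=; case: (f p). Qed.

Lemma cont_pns s p q : cont (pns s p) q = if q == p then hold s else cont s q.
Proof.
rewrite /pns; case: s => [[x|] f] /=; case E: (f p) => [y|] //=.
by case: eqP => [->|].
Qed.

Section Instance.

Variable pi : seq nat.
Hypothesis Hpi : is_instance pi.
Implicit Types (c d g k n p q t u x : nat) (G H K L P : seq nat).
Implicit Types (gs r : seq (seq nat)) (s : state).

Local Notation m := (size pi).
Local Notation pf := (pf pi).

(** * Orbits of the permutation *)

Lemma pi_uniq : uniq pi.
Proof. by rewrite (perm_uniq Hpi) iota_uniq. Qed.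

Lemma pf_range q : 1 <= q <= m -> 1 <= pf q <= m.
Proof.
move=> Hq; have lq : q.-1 < m by lia.
have : pf q \in pi by apply: mem_nth.
by rewrite (perm_mem Hpi) mem_iota; lia.
Qed.

Lemma pf_inj i j : 1 <= i <= m -> 1 <= j <= m -> pf i = pf j -> i = j.
Proof.
move=> Hi Hj; have [li lj] : i.-1 < m /\ j.-1 < m by lia.
by move/eqP; rewrite /Defs.pf nth_uniq ?pi_uniq // => /eqP; lia.
Qed.

Lemma iter_pf_range n q : 1 <= q <= m -> 1 <= iter n pf q <= m.
Proof. by move=> Hq; elim: n => //= n; apply: pf_range. Qed.

Lemma iter_pf_inj n i j :
  1 <= i <= m -> 1 <= j <= m -> iter n pf i = iter n pf j -> i = j.
Proof.
move=> Hi Hj; elim: n => //= n IH /pf_inj E; apply: IH; apply: E; exact: iter_pf_range.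
Qed.

(** Pigeonhole: [m.+1] distinct iterates would not fit into [m] cells. Hence cutting [orb] off after
    [m] steps loses no element of the cycle. *)
Lemma looping_pf q : 1 <= q <= m -> looping pf q m.
Proof.
move=> Hq; apply/negPn; rewrite -looping_uniq; apply/negP => /uniq_leq_size H.
have := H (iota 1 m); rewrite size_traject size_iota ltnn => F; apply: notF; apply: F.
by move=> x /trajectP[i _ ->]; rewrite mem_iota add1n ltnS iter_pf_range.
Qed.

Lemma mem_orbP q x : 1 <= q <= m ->
  reflect (exists i, x = iter i pf q) (x \in orb pi q).
Proof.
move=> Hq; apply: (iffP idP) => [/trajectP[i _ ->]|[i ->]]; first by exists i.
by move/loopingP: (looping_pf Hq); apply.
Qed.

Lemma pf_period q : 1 <= q <= m -> exists2 t, 0 < t & iter t pf q = q.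
Proof.
move=> Hq; have /trajectP[j jm E] := looping_pf Hq.
exists (m - j); first lia.
apply: (@iter_pf_inj j); rewrite ?iter_pf_range // -iterD addnC subnK //; exact: ltnW.
Qed.

Lemma orb_refl q : 1 <= q <= m -> q \in orb pi q.
Proof. by move=> Hq; apply/mem_orbP => //; exists 0. Qed.

Lemma orb_range q x : 1 <= q <= m -> x \in orb pi q -> 1 <= x <= m.
Proof. by move=> Hq /(mem_orbP _ Hq)[i ->]; apply: iter_pf_range. Qed.

Lemma iter_period t q n : iter t pf q = q -> iter (n * t) pf q = q.
Proof. by move=> E; elim: n => // n IH; rewrite mulSn iterD IH. Qed.

Lemma orb_sym q x : 1 <= q <= m -> x \in orb pi q -> q \in orb pi x.
Proof.
move=> Hq xq; have Hx := orb_range Hq xq; apply/(mem_orbP _ Hx).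
have [i ->] := mem_orbP _ Hq xq; have [t t0 E] := pf_period Hq.
exists (i * t - i); rewrite -iterD subnK ?iter_period //.
by rewrite leq_pmulr.
Qed.

Lemma orb_trans q x y : 1 <= q <= m ->
  x \in orb pi q -> y \in orb pi x -> y \in orb pi q.
Proof.
move=> Hq xq; have Hx := orb_range Hq xq; have [i ->] := mem_orbP _ Hq xq.
have Hi := iter_pf_range i Hq.
by case/(mem_orbP _ Hi) => j ->; apply/(mem_orbP _ Hq); exists (j + i); rewrite iterD.
Qed.

Lemma orb_eq q x : 1 <= q <= m -> x \in orb pi q -> orb pi x =i orb pi q.
Proof.
move=> Hq xq y; have Hx := orb_range Hq xq.
by apply/idP/idP; apply: orb_trans => //; apply: orb_sym.
Qed.

Lemma cmin_mem q : 1 <= q <= m -> cmin pi q \in orb pi q.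
Proof.
by move=> Hq; rewrite /cmin; have := foldr_minn_mem q (orb pi q); rewrite inE => /orP[/eqP->|//];
  apply: orb_refl.
Qed.

Lemma cmax_mem q : 1 <= q <= m -> cmax pi q \in orb pi q.
Proof.
by move=> Hq; rewrite /cmax; have := foldr_maxn_mem q (orb pi q); rewrite inE => /orP[/eqP->|//];
  apply: orb_refl.
Qed.

Lemma cmin_le q x : x \in orb pi q -> cmin pi q <= x.
Proof. by move=> xq; apply: foldr_minn_le; rewrite inE xq orbT. Qed.

Lemma cmax_ge q x : x \in orb pi q -> x <= cmax pi q.
Proof. by move=> xq; apply: foldr_maxn_ge; rewrite inE xq orbT. Qed.

Lemma cmin_orb q x : 1 <= q <= m -> x \in orb pi q -> cmin pi x = cmin pi q.
Proof.
move=> Hq xq; have Hx := orb_range Hq xq; apply/eqP; rewrite eqn_leq.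
by rewrite !cmin_le // ?(orb_eq Hq xq) ?cmin_mem // -(orb_eq Hq xq) cmin_mem.
Qed.

Lemma cmax_orb q x : 1 <= q <= m -> x \in orb pi q -> cmax pi x = cmax pi q.
Proof.
move=> Hq xq; have Hx := orb_range Hq xq; apply/eqP; rewrite eqn_leq.
by rewrite !cmax_ge // ?(orb_eq Hq xq) ?cmax_mem // -(orb_eq Hq xq) cmax_mem.
Qed.

Lemma orb_cmin q x : 1 <= q <= m -> 1 <= x <= m -> cmin pi x = cmin pi q -> x \in orb pi q.
Proof.
move=> Hq Hx E; apply: (@orb_trans _ (cmin pi q)) => //; first exact: cmin_mem.
by apply: orb_sym => //; rewrite -E cmin_mem.
Qed.

Lemma nontriv_range q : nontriv pi q -> 1 <= q <= m.
Proof. by case/andP. Qed.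

Lemma nontriv_orb q x : nontriv pi q -> x \in orb pi q -> nontriv pi x.
Proof.
move=> nq xq; have Hq := nontriv_range nq; have Hx := orb_range Hq xq.
rewrite /nontriv Hx /=; apply/eqP => fx.
have [i Ei] := mem_orbP _ Hx (orb_sym Hq xq).
have Exq : q = x by rewrite Ei; elim: (i) => //= j ->.
by case/andP: nq => _ /eqP []; rewrite Exq.
Qed.

Lemma pf_orb q : 1 <= q <= m -> pf q \in orb pi q.
Proof. by move=> Hq; apply/mem_orbP => //; exists 1. Qed.

Local Notation reps := (cyc_reps pi).

Lemma mem_reps c : (c \in reps) = nontriv pi c && (cmin pi c == c).
Proof.
rewrite mem_filter mem_iota andb_idr // => /andP[/nontriv_range]; lia.
Qed.

Lemma reps_sorted : sorted ltn reps.
Proof. by apply: sorted_filter; [exact: ltn_trans | exact: iota_ltn_sorted]. Qed.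

Lemma reps_uniq : uniq reps.
Proof. by rewrite filter_uniq ?iota_uniq. Qed.

Lemma reps_nontriv c : c \in reps -> nontriv pi c.
Proof. by rewrite mem_reps => /andP[]. Qed.

Lemma reps_cmin c : c \in reps -> cmin pi c = c.
Proof. by rewrite mem_reps => /andP[_ /eqP]. Qed.

Lemma cmin_rep q : nontriv pi q -> cmin pi q \in reps.
Proof.
move=> nq; have Hq := nontriv_range nq; have cq := cmin_mem Hq.
by rewrite mem_reps (nontriv_orb nq cq) (cmin_orb Hq cq) eqxx.
Qed.

Lemma cmin_leq q : 1 <= q <= m -> cmin pi q <= q.
Proof. by move=> Hq; apply/cmin_le/orb_refl. Qed.

Lemma leq_cmax q : 1 <= q <= m -> q <= cmax pi q.
Proof. by move=> Hq; apply/cmax_ge/orb_refl. Qed.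

Lemma cmax_cmin q : 1 <= q <= m -> cmax pi (cmin pi q) = cmax pi q.
Proof. by move=> Hq; apply: cmax_orb => //; apply: cmin_mem. Qed.

Lemma rep_lt_cmax c : c \in reps -> c < cmax pi c.
Proof.
move=> cr; have /andP[Hc ne] := reps_nontriv cr.
have := leq_cmax Hc; rewrite leq_eqVlt => /orP[/eqP E|//].
have := cmax_ge (pf_orb Hc); have := cmin_le (pf_orb Hc).
rewrite (reps_cmin cr) -E; lia.
Qed.

Lemma nontriv_preim a : nontriv pi a ->
  exists b, [/\ nontriv pi b, pf b = a & cmin pi b = cmin pi a].
Proof.
move=> na; have Ha := nontriv_range na; have [[//|t] _ /= E] := pf_period Ha.
have bo : iter t pf a \in orb pi a by apply/mem_orbP => //; exists t.
by exists (iter t pf a); rewrite (nontriv_orb na bo) (cmin_orb Ha bo).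
Qed.

(** The list [rcons l c] is the order in which pure cycle following delivers after the pick at [c]:
    it begins at [pf c] and ends at [c]. *)
Lemma cycle_list c : c \in reps -> exists l,
  [/\ uniq (rcons l c), fpath pf c (rcons l c)
    & forall q, (q \in rcons l c) = nontriv pi q && (cmin pi q == c)].
Proof.
move=> cr; have nc := reps_nontriv cr; have Hc := nontriv_range nc.
have ex : exists t, (0 < t) && (iter t pf c == c).
  by have [t t0 E] := pf_period Hc; exists t; rewrite t0 E eqxx.
case: (ex_minnP ex) => t /andP[t0 /eqP Et] tmin.
case: t t0 Et tmin => // t _ Et tmin.
have El : rcons (traject pf (pf c) t) c = traject pf (pf c) t.+1.
  by rewrite trajectSr -iterSr Et.
exists (traject pf (pf c) t); rewrite El; split.
(* A repetition among the iterates would yield the period [t - j], below the least period [t.+1]. *)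
- rewrite looping_uniq; apply/negP => /trajectP[j jt].
  rewrite -!iterSr => E; have Ej := subnK (ltnW jt).
  have E2 : iter (t - j) pf c = c.
    apply: (@iter_pf_inj j.+1); rewrite ?iter_pf_range // -iterD.
    by rewrite (_ : j.+1 + (t - j) = t.+1) ?E //; lia.
  by have := tmin (t - j); rewrite E2 eqxx andbT; lia.
- exact: fpath_traject.
- move=> q; rewrite -El; apply/idP/idP => [|/andP[nq /eqP E]].
    rewrite El => /trajectP[j _ ->]; rewrite -iterSr.
    have jo : iter j.+1 pf c \in orb pi c by apply/mem_orbP => //; exists j.+1.
    by rewrite (nontriv_orb nc jo) (cmin_orb Hc jo) (reps_cmin cr) eqxx.
  have Hq := nontriv_range nq.
  have : q \in orb pi c by apply: orb_cmin => //; rewrite E (reps_cmin cr).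
  case/(mem_orbP _ Hc) => i ->; rewrite (divn_eq i t.+1) addnC iterD iter_period //.
  have := ltn_pmod i (ltn0Sn t); case: (i %% t.+1) => [|j] jt /=.
    by rewrite mem_rcons inE eqxx.
  by rewrite El -iterS iterSr; apply/trajectP; exists j => //; lia.
Qed.


(** * Cycle groups and their intervals *)

Local Notation gmin := (gmin pi).
Local Notation gmax := (gmax pi).

Lemma gmin_mem G : G != [::] -> gmin G \in G.
Proof.
case: G => // c G _; have := foldr_minn_mem c (c :: G).
by rewrite /Defs.gmin /= !inE => /orP[->|].
Qed.

Lemma gmin_le G c : c \in G -> gmin G <= c.
Proof. by move=> cG; apply: foldr_minn_le; rewrite inE cG orbT. Qed.

Lemma gmax_ge G c : c \in G -> cmax pi c <= gmax G.
Proof. by move=> cG; apply: foldr_maxn_ge; rewrite inE map_f ?orbT. Qed.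

Lemma lt_gmaxP G k : k < gmax G -> exists2 c, c \in G & k < cmax pi c.
Proof.
rewrite /Defs.gmax; have := foldr_maxn_mem 0 [seq cmax pi c | c <- G].
rewrite inE => /orP[/eqP-> //|/mapP[c cG ->] kc]; by exists c.
Qed.

(** Here [k] stands for the edge [(k, k+1)]: the interval of the group has no edge that is left
    uncovered by its cycles. *)
Definition connected G := forall k, gmin G <= k < gmax G ->
  exists2 c, c \in G & c <= k < cmax pi c.

(** The two intervals share a cell, so each edge of their union lies inside one of them. *)
Lemma connected_cat G H : G != [::] -> H != [::] -> ginter pi G H ->
  connected G -> connected H -> connected (G ++ H).
Proof.
move=> G0 H0 /andP[GH HG] cG cH k /andP[k1 /lt_gmaxP[c cGH kc]].
have k1' : (gmin G <= k) || (gmin H <= k).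
  have : gmin (G ++ H) \in G ++ H by apply: gmin_mem; case: (G) G0.
  by rewrite mem_cat => /orP[]/gmin_le/leq_trans/(_ k1)->; rewrite ?orbT.
have k2 : (k < gmax G) || (k < gmax H).
  by move: cGH; rewrite mem_cat => /orP[]/gmax_ge/(leq_trans kc)->; rewrite ?orbT.
have [/cG|/cH] : (gmin G <= k < gmax G) \/ (gmin H <= k < gmax H) by lia.
- by move=> [d dG dk]; exists d => //; rewrite mem_cat dG.
- by move=> [d dG dk]; exists d => //; rewrite mem_cat dG orbT.
Qed.

Lemma merge_into_some G gs r : merge_into pi G gs = Some r ->
  exists H gs1 gs2, [/\ gs = gs1 ++ H :: gs2, r = gs1 ++ (G ++ H) :: gs2 & ginter pi G H].
Proof.
elim: gs r => // H gs IH r /=; case: ifP => [i [<-]|_]; first by exists H, [::], gs.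
case E: merge_into => [r'|//] [<-]; have [K [gs1 [gs2 [-> -> i]]]] := IH _ E.
by exists K, (H :: gs1), gs2.
Qed.

Lemma merge_into_none G gs : merge_into pi G gs = None ->
  all (fun H => ~~ ginter pi G H) gs.
Proof.
by elim: gs => //= H gs IH; case: ifP => //=; case: merge_into IH => //= ->.
Qed.

Lemma merge_step_some gs r : merge_step pi gs = Some r ->
  exists G H gs1 gs2 gs3, [/\ gs = gs1 ++ G :: gs2 ++ H :: gs3,
    r = gs1 ++ gs2 ++ (G ++ H) :: gs3 & ginter pi G H].
Proof.
elim: gs r => // G gs IH r /=; case E: merge_into => [r'|].
  move=> [<-]; have [H [gs1 [gs2 [-> -> i]]]] := merge_into_some E.
  by exists G, H, [::], gs1, gs2.
case E': merge_step => [r'|//] [<-]; have [K [H [gs1 [gs2 [gs3 [-> -> i]]]]]] := IH _ E'.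
by exists K, H, (G :: gs1), gs2, gs3.
Qed.

Lemma merge_step_none gs : merge_step pi gs = None ->
  pairwise (fun G H => ~~ ginter pi G H) gs.
Proof.
elim: gs => //= G gs IH; case E: merge_into => [//|].
by rewrite (merge_into_none E); case: merge_step IH => //= ->.
Qed.

Definition grouping gs := [/\ perm_eq (flatten gs) reps,
  forall G, G \in gs -> G != [::] & forall G, G \in gs -> connected G].

Lemma merge_step_grouping gs r : merge_step pi gs = Some r -> grouping gs ->
  grouping r /\ size gs = (size r).+1.
Proof.
case/merge_step_some => G [H [gs1 [gs2 [gs3 [-> -> i]]]]] [p ne co].
have inG : G \in gs1 ++ G :: gs2 ++ H :: gs3 by rewrite !(mem_cat, inE) eqxx orbT.
have inH : H \in gs1 ++ G :: gs2 ++ H :: gs3 by rewrite !(mem_cat, inE) eqxx !orbT.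
have sub K : K \in gs1 ++ gs2 ++ (G ++ H) :: gs3 ->
    (K \in gs1 ++ G :: gs2 ++ H :: gs3) \/ K = G ++ H.
  rewrite !(mem_cat, inE) => /or4P[->|->|/eqP|->]; rewrite ?orbT; auto.
split; last by rewrite !size_cat /= !size_cat /= !addnS.
split.
- rewrite -(permPr p) !flatten_cat /= !flatten_cat /= perm_cat2l.
  by rewrite !catA perm_cat2r perm_cat2r perm_catC.
- by move=> K /sub[/ne //|->]; case: (G) (ne _ inG).
- move=> K /sub[/co //|->]; apply: connected_cat; auto.
Qed.

(** Each merge removes one group, so fuel equal to the number of groups is exhausted only when no
    merge is possible any more. *)
Lemma merge_iter_grouping n gs : grouping gs -> size gs <= n ->
  grouping (merge_iter pi n gs) /\
  pairwise (fun G H => ~~ ginter pi G H) (merge_iter pi n gs).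
Proof.
elim: n gs => [|n IH] gs g; first by case: gs g.
move=> /= sz; case E: merge_step => [r|]; last by split; last exact: merge_step_none.
by have [gr sr] := merge_step_grouping E g; apply: IH => //; rewrite -ltnS -sr.
Qed.

Lemma groups_spec : grouping (groups pi) /\
  pairwise (fun G H => ~~ ginter pi G H) (groups pi).
Proof.
apply: merge_iter_grouping; last by rewrite size_map.
split=> [|G /mapP[c cr ->] //|G /mapP[c cr ->] k].
  by rewrite (_ : flatten _ = reps) //; elim: reps => //= c l ->.
rewrite /Defs.gmin /Defs.gmax /= minnn maxn0 => kc.
by exists c; rewrite ?inE.
Qed.

Lemma group_ne G : G \in groups pi -> G != [::].
Proof. by have [[_ ne _] _] := groups_spec; apply: ne. Qed.

Lemma mem_group G c : G \in groups pi -> c \in G -> c \in reps.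
Proof.
have [[p _ _] _] := groups_spec => GG cG; rewrite -(perm_mem p).
by apply/flattenP; exists G.
Qed.

Lemma gmin_rep G : G \in groups pi -> gmin G \in reps.
Proof. by move=> GG; apply: (mem_group GG); apply/gmin_mem/group_ne. Qed.

Lemma rep_group c : c \in reps -> exists2 G, G \in groups pi & c \in G.
Proof.
have [[p _ _] _] := groups_spec; rewrite -(perm_mem p).
by move/flattenP => [G]; exists G.
Qed.

Lemma gmin_gmax G : G \in groups pi -> gmin G < gmax G.
Proof.
move=> GG; apply: leq_trans (rep_lt_cmax (gmin_rep GG)) _.
by apply/gmax_ge/gmin_mem/group_ne.
Qed.

Lemma ginterI G H x :
  gmin G <= x <= gmax G -> gmin H <= x <= gmax H -> ginter pi G H.
Proof. by rewrite /ginter; lia. Qed.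

Lemma group_disjoint G H x : G \in groups pi -> H \in groups pi ->
  gmin G <= x <= gmax G -> gmin H <= x <= gmax H -> G = H.
Proof.
have [_ /(pairwiseP [::]) pw] := groups_spec.
move=> /(nthP [::])[i ig <-] /(nthP [::])[j jg <-] xi xj.
case: (ltngtP i j) => [ij|ji|->//].
- by have := ginterI xi xj; rewrite (negPf (pw i j ig jg ij)).
- by have := ginterI xj xi; rewrite (negPf (pw j i jg ig ji)).
Qed.

(** The search stops at some group whose interval contains [q]; disjointness identifies it with the
    group that contains the cycle of [q]. *)
Lemma group_of_spec q : nontriv pi q ->
  [/\ group_of pi q \in groups pi, cmin pi q \in group_of pi q
    & gmin (group_of pi q) <= q <= gmax (group_of pi q)].
Proof.
move=> nq; have Hq := nontriv_range nq.
have [G GG cG] := rep_group (cmin_rep nq).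
have qG : gmin G <= q <= gmax G.
  rewrite (leq_trans (gmin_le cG)) ?cmin_leq //.
  by rewrite (leq_trans (leq_cmax Hq)) // -cmax_cmin // gmax_ge.
rewrite /group_of; set a := (fun K => _).
have hs : has a (groups pi) by apply/hasP; exists G.
have aq : a (nth [::] (groups pi) (find a (groups pi))) := nth_find [::] hs.
have inq : nth [::] (groups pi) (find a (groups pi)) \in groups pi.
  by rewrite mem_nth // -has_find.
by rewrite [nth _ _ _](group_disjoint inq GG aq qG).
Qed.

(** No cycle spans the edge to the right of [q]. Inside the interval of a group this characterizes
    its right end, without reference to the merging process. *)
Definition brk q := forall c, c \in reps -> c <= q -> cmax pi c <= q.

(** A cycle spanning the edge after [gmax G] would put [gmax G] into the interval of its own group,
    which is then [G] itself and ends at [gmax G]. *)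
Lemma gmax_brk G : G \in groups pi -> brk (gmax G).
Proof.
move=> GG c cr cle; have [H HH cH] := rep_group cr.
have ch := gmax_ge cH; have lh := gmin_le cH; have := rep_lt_cmax cr.
case: (leqP (cmax pi c) (gmax G)) => // lt _.
have E : G = H by apply: (@group_disjoint _ _ (gmax G)) => //; have := gmin_gmax GG; lia.
by move: lt; rewrite ltnNge E ch.
Qed.

Lemma brk_gmax G q : G \in groups pi -> gmin G <= q <= gmax G -> brk q -> gmax G = q.
Proof.
move=> GG /andP[q1 q2] b; apply/eqP; rewrite eqn_leq q2 andbT leqNgt; apply/negP => lt.
have [[_ _ /(_ _ GG) co] _] := groups_spec.
have [|c cG /andP[c1 c2]] := co q; first by rewrite q1.
by have := b c (mem_group GG cG) c1; rewrite leqNgt c2.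
Qed.

Lemma next_group_none G : (forall c, c \in reps -> c <= gmax G) -> next_group pi G = None.
Proof.
move=> h; rewrite /next_group.
rewrite (_ : [seq H <- groups pi | gmax G < gmin H] = [::]) //.
apply/eqP; rewrite -[_ == _]negbK -has_filter; apply/negP => /hasP[H HH].
by rewrite ltnNge h // gmin_rep.
Qed.

(** The group of [u] lies entirely beyond [G], for otherwise both intervals would contain [gmax G];
    minimality of [u] then makes it the left end of that group. *)
Lemma next_group_some G u : G \in groups pi -> u \in reps -> gmax G < u ->
  (forall c, c \in reps -> gmax G < c -> u <= c) ->
  exists2 H, next_group pi G = Some H & gmin H = u.
Proof.
move=> GG ur Gu umin; rewrite /next_group.
set R := [seq H <- groups pi | gmax G < gmin H].
have [H HH uH] := rep_group ur.
have gHu := gmin_le uH; have guH := gmax_ge uH; have := rep_lt_cmax ur => uc.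
have GH : gmax G < gmin H.
  case: (ltnP (gmax G) (gmin H)) => // le.
  have E : G = H by apply: (@group_disjoint _ _ (gmax G)) => //; have := gmin_gmax GG; lia.
  by move: Gu guH; rewrite E; lia.
have Hu : gmin H = u by apply/eqP; rewrite eqn_leq gHu umin // gmin_rep.
have HR : H \in R by rewrite mem_filter GH.
have Ru K : K \in R -> u <= gmin K.
  by rewrite mem_filter => /andP[gK KK]; apply: umin => //; apply: gmin_rep.
case ER: R => [|H0 R']; first by rewrite ER in HR.
rewrite -ER; set v := foldr _ _ _.
have Ev : v = u.
  apply/eqP; rewrite eqn_leq; apply/andP; split.
    by rewrite /v -Hu; apply: foldr_minn_le; rewrite inE map_f ?orbT.
  have := foldr_minn_mem (gmin H0) [seq gmin K | K <- R].
  rewrite -/v inE => /orP[/eqP->|/mapP[K KR ->]]; last exact: Ru.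
  by apply: Ru; rewrite ER mem_head.
have hs : has (fun K => gmin K == v) R by apply/hasP; exists H => //; rewrite Hu Ev.
eexists; first by [].
by have /eqP := nth_find [::] hs; rewrite Ev.
Qed.

Lemma first_unstartedP G st : match first_unstarted G st with
  | Some c => [/\ c \in G, c \notin st & forall d, d \in G -> d \notin st -> c <= d]
  | None => {subset G <= st} end.
Proof.
rewrite /first_unstarted; set F := [seq c <- _ | _].
have mF c : (c \in F) = (c \in G) && (c \notin st) by rewrite mem_filter mem_sort andbC.
have sF : sorted leq F.
  by apply: sorted_filter; [exact: leq_trans | apply/sort_sorted/leq_total].
case EF: F => [|c F'] /=.
  by move=> c cG; apply/negPn/negP => ns; have := mF c; rewrite EF cG ns.
have := mF c; rewrite EF mem_head => /esym/andP[cG ns]; split=> // d dG dns.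
have := mF d; rewrite EF dG dns inE => /orP[/eqP->//|dF'].
by move: sF; rewrite EF /= (path_sortedE leq_trans) => /andP[/allP/(_ _ dF')].
Qed.

(** * Lower bound on the number of pick-n-swaps *)

Definition ntcells := [seq q <- iota 1 m | nontriv pi q].

Lemma mem_ntcells q : (q \in ntcells) = nontriv pi q.
Proof. by rewrite mem_filter mem_iota andb_idr // => /nontriv_range; lia. Qed.

Lemma ntcells_uniq : uniq ntcells.
Proof. by rewrite filter_uniq ?iota_uniq. Qed.

Lemma cont_untouched P s q : q \notin P -> cont (foldl pns s P) q = cont s q.
Proof.
elim: P s => //= p P IH s; rewrite inE negb_or => /andP[qp qP].
by rewrite IH // cont_pns (negPf qp).
Qed.

(** An item leaves its cell only by a visit there. The last hypothesis survives each step because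
    the item put down is never [a]. *)
Lemma item_unmoved (a b : nat) P s : b \notin P -> hold s <> Some a ->
  (forall q, cont s q = Some a -> q = b) -> hold (foldl pns s P) <> Some a.
Proof.
elim: P s => //= p P IH s; rewrite inE negb_or => /andP[/eqP bp bP] hs cs; apply: IH => //.
  by rewrite hold_pns => /cs E; apply: bp.
by move=> q; rewrite cont_pns; case: eqP => // _ /cs.
Qed.

Lemma cont_init q : 1 <= q <= m -> cont (init pi) q = Some (pf q).
Proof. by move=> Hq /=; rewrite Hq. Qed.

Lemma valid_visits P q : valid pi P -> nontriv pi q -> q \in P.
Proof.
case=> _ [_ fin] nq; apply/negPn/negP => qP; have Hq := nontriv_range nq.
have := fin q Hq; rewrite /run cont_untouched // cont_init // => -[E].
by case/andP: nq => _ /eqP.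
Qed.

(* Putting item [a] home at the last visit of cell [a] requires that it was
   fetched from its initial cell before; so the first visited cell of a cycle
   is visited again. *)
Lemma cycle_visited_twice P c : valid pi P -> c \in reps ->
  exists a, [/\ nontriv pi a, cmin pi a = c & 1 < count_mem a P].
Proof.
move=> vP cr; pose f q := nontriv pi q && (cmin pi q == c).
have hf : has f P.
  apply/hasP; exists c; first exact: valid_visits (reps_nontriv cr).
  by rewrite /f (reps_nontriv cr) (reps_cmin cr) eqxx.
case: vP => _ [_ fin].
move: fin; case: (split_find hf) => a P1 P2 /andP[na /eqP ca] nf fin.
exists a; split=> //; rewrite count_cat -cats1 count_cat /= eqxx.
rewrite addn0 addn1 addSn ltnS.
suff : a \in P2 by rewrite -has_pred1 has_count => /leq_trans->; rewrite ?leq_addl.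
apply/negPn/negP => aP2; have Ha := nontriv_range na.
have := fin a Ha; rewrite /run foldl_cat cont_untouched // foldl_rcons cont_pns eqxx.
have [b [nb ba cb]] := nontriv_preim na.
apply: (@item_unmoved a b) => //.
  apply: contra nf => bP; apply/hasP; exists b => //.
  by rewrite /f nb cb ca eqxx.
move=> q /=; case: ifP => // Hq [E]; apply: pf_inj => //.
  exact: nontriv_range.
by rewrite ba.
Qed.

Lemma sum_count_leq (s P : seq nat) : uniq s -> \sum_(q <- s) count_mem q P <= size P.
Proof.
move=> us; elim: P => [|p P IH] /=; first by rewrite big1_seq.
rewrite big_split /= -add1n leq_add //.
have -> : \sum_(q <- s) (p == q) = count_mem p s.
  by rewrite -sum1_count [RHS]big_mkcond /=; apply: eq_bigr => q _; rewrite eq_sym; case: eqP.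
by rewrite count_uniq_mem //; case: (_ \in _).
Qed.

Lemma swaps_lower_bound P : valid pi P -> size ntcells + size reps <= size P.
Proof.
move=> vP; apply: leq_trans (sum_count_leq P ntcells_uniq).
pose D := [seq q <- ntcells | 1 < count_mem q P].
(* [cmin] maps the cells visited at least twice onto the representatives. *)
have le : size reps <= size D.
  rewrite -(size_map (cmin pi) D); apply: uniq_leq_size (reps_uniq) _ => c cr.
  have [a [na <- ca]] := cycle_visited_twice vP cr.
  by apply: map_f; rewrite mem_filter ca mem_ntcells.
apply: leq_trans (_ : \sum_(q <- ntcells) (1 + (1 < count_mem q P)) <= _).
  rewrite big_split /= sum1_size leq_add2l (leq_trans le) //.
  by rewrite size_filter -sum1_count big_mkcond /= leq_sum // => q _; case: ifP.
rewrite big_seq [X in _ <= X]big_seq; apply: leq_sum => q.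
rewrite mem_ntcells => nq; have := valid_visits vP nq.
by rewrite -has_pred1 has_count; lia.
Qed.

(** * Edge crossings and the lower bound on travel *)

Definition rcross k a P := sumn (pairmap (fun x y => nat_of_bool (x <= k < y)) a P).
Definition lcross k a P := sumn (pairmap (fun x y => nat_of_bool (y <= k < x)) a P).

Lemma rcross_cons k a p P : rcross k a (p :: P) = (a <= k < p) + rcross k p P.
Proof. by []. Qed.

(** The net number of crossings depends only on the sides on which the walk begins and ends; for a
    closed walk both directions balance. *)
Lemma rcross_lcross k a P : rcross k a P + (last a P <= k) = lcross k a P + (a <= k).
Proof.
elim: P a => //= p P IH a; have := IH p; rewrite /rcross /lcross /=; lia.
Qed.

Lemma rcross_rcons k a P x : rcross k a (rcons P x) = rcross k a P + (last a P <= k < x).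
Proof.
by elim: P a => [|p P IH] a /=; rewrite !rcross_cons ?IH ?addnA // /rcross /= addnC.
Qed.

Lemma sum_between N a b : 0 < a -> b <= N -> \sum_(1 <= k < N) (a <= k < b) = b - a.
Proof.
(* Capping at [minn N b] frees the claim from [b <= N], so that induction on [N] applies. *)
move=> a0 bN; have -> : b - a = minn N b - a by lia.
elim: N {bN} => [|N IH]; first by rewrite big_geq //; lia.
case: N IH => [|N] IH; first by rewrite big_geq //; lia.
by rewrite big_nat_recr //= IH; lia.
Qed.

Lemma sumn_dist N a P : all (fun p => 1 <= p <= N) (a :: P) ->
  sumn (pairmap dist a P) = \sum_(1 <= k < N) (rcross k a P + lcross k a P).
Proof.
elim: P a => [|p P IH] a /=; first by rewrite big1.
move=> /and3P[Ha Hp HP]; rewrite (IH p) /= ?Hp //.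
have -> : dist a p = \sum_(1 <= k < N) ((a <= k < p) + (p <= k < a)).
  by rewrite big_split /= !sum_between //; rewrite /dist; lia.
rewrite -big_split /=; apply: eq_bigr => k _; rewrite /rcross /lcross /=; lia.
Qed.

Lemma travel_rcross P : all (fun p => 1 <= p <= m) P ->
  travel P = \sum_(1 <= k < m.+1) 2 * rcross k 1 P.
Proof.
(* The bound [m.+1] instead of [m] keeps cell 1 in range even for [m = 0]. *)
move=> HP; rewrite /travel (@sumn_dist m.+1); last first.
  rewrite /= all_rcons /=; apply: sub_all HP => p; lia.
apply: eq_big_nat => k /andP[k1 _].
have := rcross_lcross k 1 (rcons P 1); rewrite last_rcons rcross_rcons; lia.
Qed.

Definition itemgt k (o : option nat) := if o is Some g then k < g else false.

(* [a] is the position of the end-effector, hence of the held item. *)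
Definition pending k s a :=
  \sum_(q <- iota 1 m) ((q <= k) && itemgt k (cont s q)) + ((a <= k) && itemgt k (hold s)).

(** [pending] counts the items at or left of [k] whose goal lies beyond [k]. At the cell [p], the
    swap merely exchanges the two summands belonging to [p] and to the hand. *)
Lemma pending_pns k s p : 1 <= p <= m -> pending k (pns s p) p = pending k s p.
Proof.
move=> Hp; have pm : p \in iota 1 m by rewrite mem_iota; lia.
rewrite /pending !(bigD1_seq p) ?iota_uniq //= hold_pns cont_pns eqxx.
rewrite (eq_bigr (fun q => nat_of_bool ((q <= k) && itemgt k (cont s q)))).
  by rewrite addnAC [X in X + _]addnC addnAC.
by move=> q /negPf qp; rewrite cont_pns qp.
Qed.

(** [pending] drops only when a counted item is carried across the edge, by one per rightward
    crossing. *)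
Lemma pending_leq_rcross k P s a : all (fun p => 1 <= p <= m) P ->
  pending k s a <= rcross k a P + pending k (foldl pns s P) (last a P).
Proof.
elim: P s a => [|p P IH] s a //= /andP[Hp HP].
have := IH (pns s p) p HP; rewrite pending_pns // rcross_cons /pending.
by case: (itemgt _ (hold s)); lia.
Qed.

Lemma rcross_gt0 k a p P : a <= k -> p \in P -> k < p -> 0 < rcross k a P.
Proof.
elim: P a => //= x P IH a ak; rewrite inE rcross_cons => /orP[/eqP-> kx|pP kp].
  by rewrite ak kx.
case: (leqP x k) => xk; last by rewrite ak.
by rewrite (leq_trans (IH x xk pP kp)) // leq_addl.
Qed.

Definition crossings k := pending k (init pi) 1.
(** The second summand charges one passage through an edge that no item crosses but beyond which
    some cycle begins. *)
Definition need k := crossings k + ((crossings k == 0) && has (fun c => k < c) reps).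

Lemma rcross_lower_bound P k : valid pi P -> 0 < k -> need k <= rcross k 1 P.
Proof.
move=> vP k0; have [rP [hN fin]] := vP.
have := pending_leq_rcross k (init pi) 1 rP; rewrite -/(run pi P) {2}/pending hN /= andbF addn0.
(* In the final state every item is home and the hand is empty, so nothing is pending. *)
rewrite big1_seq; last first.
  by move=> q /= qm; rewrite fin /=; [case: leqP | move: qm; rewrite mem_iota; lia].
rewrite addn0 -/(crossings k) /need; case: eqP => [-> _|_]; last by rewrite addn0.
case: hasP => //= -[c cr kc]; apply: (rcross_gt0 (p := c)) => //.
exact: valid_visits (reps_nontriv cr).
Qed.

(** * Started cycles as a prefix of the sorted representatives *)

Local Notation rep n := (nth 0 reps n).
Local Notation top n := (gmax (take n reps)).

Lemma rep_mem n : n < size reps -> rep n \in reps.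
Proof. exact: mem_nth. Qed.

Lemma rep_lt i j : i < j -> j < size reps -> rep i < rep j.
Proof.
move=> ij js; apply: (sorted_ltn_nth ltn_trans 0 reps_sorted) => //; exact: ltn_trans js.
Qed.

(** As cycles are started from left to right, the number [n] alone encodes the set of started
    cycles, and membership becomes a comparison with the next one, [rep n]. *)
Lemma mem_take_reps n c : n < size reps -> c \in reps ->
  (c \in take n reps) = (c < rep n).
Proof.
move=> ns cr; rewrite in_take //; have cs : index c reps < size reps by rewrite index_mem.
have Ec := nth_index 0 cr; case: (ltngtP (index c reps) n) => [lt|lt|E].
- by rewrite -Ec rep_lt.
- by have := rep_lt lt cs; rewrite Ec => /ltnW; rewrite leqNgt => /negPf.
- by rewrite -E Ec ltnn.
Qed.

Lemma take_repsS n : n < size reps -> take n.+1 reps = rcons (take n reps) (rep n).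
Proof. exact: take_nth. Qed.

Lemma take_reps_sub n c : c \in take n reps -> c \in reps.
Proof. exact: mem_take. Qed.

Definition started n q := nontriv pi q && (cmin pi q \in take n reps).

Lemma startedS n q : n < size reps ->
  started n.+1 q = started n q || (nontriv pi q && (cmin pi q == rep n)).
Proof.
by move=> ns; rewrite /started take_repsS // mem_rcons inE andb_orr orbC.
Qed.

Lemma started_range n q : started n q -> 1 <= q <= m.
Proof. by case/andP => /nontriv_range. Qed.

Lemma started_le_top n q : started n q -> q <= top n.
Proof.
case/andP => nq cq; have Hq := nontriv_range nq; apply: leq_trans (leq_cmax Hq) _.
by rewrite -(cmax_cmin Hq); apply: gmax_ge.
Qed.

Lemma top_leq n q : (forall c, c \in take n reps -> cmax pi c <= q) -> top n <= q.
Proof.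
by move=> h; rewrite leqNgt; apply/negP => /lt_gmaxP[c /h cq]; rewrite ltnNge cq.
Qed.

Lemma topS n : n < size reps -> top n.+1 = maxn (cmax pi (rep n)) (top n).
Proof.
move=> ns; rewrite take_repsS //; apply/eqP; rewrite eqn_leq geq_max gmax_ge ?mem_rcons ?mem_head //.
apply/andP; split; last first.
  by apply: top_leq => c ct; apply: gmax_ge; rewrite mem_rcons inE ct orbT.
rewrite -take_repsS //; apply: top_leq => c; rewrite take_repsS // mem_rcons inE leq_max.
by case/orP => [/eqP->|ct]; rewrite ?leqnn // gmax_ge ?orbT.
Qed.

(** * The itinerary of the end-effector *)

(** Each cell of the list contains the item bound for the next cell of the list; the last cell is
    empty, since [ohead [::]] is [None]. *)
Fixpoint chain (f : nat -> option nat) L :=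
  if L is x :: L' then (f x == ohead L') && chain f L' else true.

Lemma eq_in_chain (f1 f2 : nat -> option nat) L :
  {in L, f1 =1 f2} -> chain f1 L = chain f2 L.
Proof.
elim: L => //= x L IH h; rewrite h ?mem_head // IH // => y yL.
by apply: h; rewrite inE yL orbT.
Qed.

(* [L] is the itinerary of the end-effector if no further cycle were started:
   the goal of the held item, the goal of the item found there, and so on. *)
Definition route n s L := [/\ n <= size reps, hold s = ohead L, chain (cont s) L & uniq L]
  /\ [/\ all (started n) L,
     forall q, 1 <= q <= m -> ~~ started n q -> cont s q = Some (pf q)
   & forall q, started n q -> q \notin L -> cont s q = Some q].

Lemma route_init : route 0 (init pi) [::].
Proof.
split; split=> // q; first by move=> Hq _; apply: cont_init.
by rewrite /started take0 andbF.
Qed.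

Lemma route_goal n s g L : route n s (g :: L) -> route n (pns s g) L.
Proof.
move=> [[ns hs /= /andP[/eqP cg ch] /andP[gL uL]] [/= /andP[sg aL] un co]].
have eqL : {in L, cont (pns s g) =1 cont s}.
  by move=> q qL; rewrite cont_pns; case: eqP gL => // <-; rewrite qL.
split; split=> //.
- by rewrite hold_pns.
- by rewrite (eq_in_chain eqL).
- move=> q Hq nq; rewrite cont_pns; case: eqP => [E|_]; last exact: un.
  by rewrite E sg in nq.
- move=> q sq qL; rewrite cont_pns hs; case: eqP => [->//|/eqP qg].
  by apply: co => //; rewrite inE negb_or qg.
Qed.

(** The swap at [rep n] parks the held item, if any, in the cell where the new cycle ends; closing
    that cycle picks it up again and continues with [L]. This covers the first pick, the switch
    within a group and the jump to the next group alike. *)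
Lemma route_start n s L : route n s L -> n < size reps -> exists l,
  [/\ route n.+1 (pns s (rep n)) (rcons l (rep n) ++ L)
    & forall q, (q \in rcons l (rep n)) = nontriv pi q && (cmin pi q == rep n)].
Proof.
move=> [[_ hs ch uL] [aL un co]] ns; have ur := rep_mem ns; set u := rep n in ur *.
have [l [ul pl ml]] := cycle_list ur; exists l; split=> //.
have nst q : q \in rcons l u -> ~~ started n q.
  rewrite ml => /andP[nq /eqP cq]; rewrite /started cq mem_take_reps // ltnn andbF //.
have dis : ~~ has (mem (rcons l u)) L.
  by apply/hasP => -[q /(allP aL) sq /nst]; rewrite sq.
have uu : u \in rcons l u by rewrite mem_rcons mem_head.
have Hu := nontriv_range (reps_nontriv ur).
have stu : started n.+1 u.
  by rewrite startedS // reps_nontriv //= (reps_cmin ur) eqxx orbT.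
have eqL : {in L, cont (pns s u) =1 cont s}.
  move=> q qL; rewrite cont_pns; case: eqP => // E; case/negP: dis; apply/hasP.
  by exists q => //; rewrite E.
split; split=> //.
- rewrite hold_pns un ?nst //.
  by case: (l) pl => [|x l'] /= /andP[/eqP ->].
- have : chain (cont (pns s u)) L by rewrite (eq_in_chain eqL).
  have : forall q, q \in l -> cont (pns s u) q = Some (pf q).
    move=> q ql; have qr : q \in rcons l u by rewrite mem_rcons inE ql orbT.
    rewrite cont_pns; case: eqP => [E|_].
      by move: ul; rewrite rcons_uniq -E ql.
    by apply: un; rewrite ?nst //; move: qr; rewrite ml => /andP[/nontriv_range].
  (* Only the start of the path is generalized; its end [u], which now contains the parked item,
     links the new cycle to [L]. *)
  move: pl; elim: (l) {1}(u) => [|x l' IH] y /=.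
    by rewrite cont_pns eqxx hs => _ _ ->; rewrite eqxx.
  move=> /andP[_ pl'] cl chL; rewrite cl ?mem_head //.
  apply/andP; split; last by apply: (IH _ pl') => // q ql; apply: cl; rewrite inE ql orbT.
  by case: (l') pl' => [|z l''] /= /andP[/eqP ->].
- by rewrite cat_uniq ul dis uL.
- rewrite all_cat; apply/andP; split; apply/allP => q.
    by rewrite ml startedS // => ->; rewrite orbT.
  by move/(allP aL); rewrite startedS // => ->.
- move=> q Hq nq; rewrite cont_pns; case: eqP => [E|_]; first by rewrite E stu in nq.
  by apply: un => //; apply: contra nq; rewrite startedS // => ->.
- move=> q; rewrite startedS // mem_cat negb_or -ml => /orP[sq|->//] /andP[ql qL].
  rewrite cont_pns; case: eqP => [E|_]; first by rewrite E uu in ql.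
  exact: co.
Qed.

(* A started cell [q] such that no cycle spans the edge (q, q+1) is the maximum
   of its group; it may only be visited while its group is the last one started. *)
Definition on_track n a L :=
  [/\ started n a, forall q, q \in a :: L -> brk q -> top n <= q
    & n < size reps ->
      [/\ a < rep n, (top n \in L) = (a != top n) & last 0 L = rep 0]].

Lemma on_track_goal n s a g L : route n s (g :: L) -> on_track n a (g :: L) ->
  (n < size reps -> g < rep n /\ a != top n) -> on_track n g L.
Proof.
move=> [[_ _ _ /= /andP[gL _]] [/= /andP[sg _] _ _]] [sa br ot] h; split=> //.
  by move=> q qL; apply: br; rewrite inE qL orbT.
move=> ns; have [gr at_] := h ns; have [ar tL lL] := ot ns; split=> //.
  by move: tL; rewrite at_ inE eq_sym; case: eqP => //= <- _; apply: negbTE.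
(* With [L] empty, [g] would be both the final stop [rep 0] and the still unvisited [top n], but
   [top n] is at least the maximum of the first cycle and thus exceeds [rep 0]. *)
case: L {br ot h} gL lL tL => //= _ g0; rewrite at_ inE => /eqP tg.
have n0 : 0 < n by case: (n) sg => //; rewrite /started take0 andbF.
have r0 : rep 0 \in reps by apply: rep_mem; apply: leq_ltn_trans ns.
have t0 : rep 0 \in take n reps by rewrite mem_take_reps // rep_lt.
by have := gmax_ge t0; rewrite tg g0 leqNgt rep_lt_cmax.
Qed.

(** The alternatives are the very first start, the switch while passing over [rep n] on the way to
    [g], and the jump from the right end of the last started group. *)
Lemma on_track_start n s a L l : route n s L -> n < size reps ->
  (forall q, (q \in rcons l (rep n)) = nontriv pi q && (cmin pi q == rep n)) ->
  (n = 0 /\ L = [::]) \/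
  (on_track n a L /\ ((exists2 g, g \in L & a < rep n < g) \/ a = top n)) ->
  on_track n.+1 (rep n) (rcons l (rep n) ++ L).
Proof.
move=> [_ [/allP aL _ _]] ns ml hyp; have ur := rep_mem ns.
have Hu := nontriv_range (reps_nontriv ur); have uc := rep_lt_cmax ur.
have cml : cmax pi (rep n) \in rcons l (rep n).
  have co := cmax_mem Hu.
  by rewrite ml (nontriv_orb (reps_nontriv ur) co) (cmin_orb Hu co) reps_cmin ?eqxx.
split.
- by rewrite startedS // reps_nontriv // reps_cmin // eqxx orbT.
- move=> q qL b.
  (* All started cycles, the new one included, begin at or before [rep n]; if [rep n <= q], then
     [brk q] bounds all their maxima by [q]. *)
  suff uq : rep n <= q.
    apply: top_leq => c; rewrite take_repsS // mem_rcons inE => /orP[/eqP->|ct].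
      exact: b.
    have cr := take_reps_sub ct; apply: b => //; apply: leq_trans uq; apply: ltnW.
    by rewrite -mem_take_reps.
  move: qL; rewrite inE mem_cat => /or3P[/eqP->//|ql|qL].
    by move: ql; rewrite ml => /andP[/nontriv_range/cmin_leq qq /eqP <-].
  case: hyp => [[_ L0]|[[sa br /(_ ns)[ar tL _]]]]; first by rewrite L0 in qL.
  have tq : top n <= q by apply: br => //; rewrite inE qL orbT.
  case=> [[g gL /andP[_ ug]]|at_].
    by apply: leq_trans tq; apply: leq_trans (ltnW ug) _; apply/started_le_top/aL.
  (* In a jump the old [top n] has just been visited and no longer lies in [L]. *)
  have E : q = top n by apply/eqP; rewrite eqn_leq tq started_le_top ?aL.
  by move: tL; rewrite -E qL E at_ eqxx.
- move=> ns'; split; first exact: rep_lt.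
  + have -> : rep n != top n.+1 by rewrite topS //; apply/eqP; lia.
    rewrite topS // mem_cat /maxn; case: ifP => [lt|_]; last by rewrite cml.
    case: hyp => [[n0 _]|[[_ _ /(_ ns)[ar tL _]] _]].
      by move: lt; rewrite n0 take0.
    by rewrite tL; apply/orP; right; apply/eqP; lia.
  + rewrite last_cat last_rcons.
    case: hyp => [[-> ->] //|[[sa _ /(_ ns)[_ _ lL]] _]].
    (* The default 0 of [last] is not a cell, so [L] cannot be empty. *)
    case: (L) lL => //= r0; have : rep 0 \in reps by apply: rep_mem; apply: leq_ltn_trans ns.
    by rewrite -r0 mem_reps /nontriv.
Qed.

(** * The next move of the algorithm *)

Lemma rep_in_group G c : G \in groups pi -> c \in reps -> gmin G <= c <= gmax G -> c \in G.
Proof.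
move=> GG cr cG; have [H HH cH] := rep_group cr.
rewrite (@group_disjoint G H c) // gmin_le //=.
by apply: leq_trans (gmax_ge cH); apply/ltnW/rep_lt_cmax.
Qed.

(** A loaded end-effector either delivers at [g] or starts exactly [rep n]. The started set appears
    as [rev (take n reps)] because [anext] puts the newest cycle in front. *)
Lemma anext_held n a s g L : route n s (g :: L) -> on_track n a (g :: L) ->
  (anext pi a s (rev (take n reps)) = Some (g, rev (take n reps)) /\
    (n < size reps -> g < rep n /\ a != top n)) \/
  [/\ n < size reps, anext pi a s (rev (take n reps)) = Some (rep n, rev (take n.+1 reps))
    & a < rep n < g \/ a = top n].
Proof.
move=> [[ns hs _ _] [/= /andP[sg _] _ _]] [sa br ot]; rewrite /anext hs /=.
have na : nontriv pi a by case/andP: sa.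
have ng : nontriv pi g by case/andP: sg.
have Hg := nontriv_range ng.
have [CC cC aC] := group_of_spec na; set C := group_of pi a in CC cC aC *.
have [GG cG gG] := group_of_spec ng; set G := group_of pi g in GG cG gG *.
have nsr : (n < size reps) -> rev (take n.+1 reps) = rep n :: rev (take n reps).
  by move=> lt; rewrite take_repsS // rev_rcons.
have cg : n < size reps -> cmin pi g < rep n.
  by move=> lt; rewrite -mem_take_reps ?cmin_rep //; case/andP: sg.
have all_started : size reps <= n -> take n reps = reps by apply: take_oversize.
rewrite na /=; case: eqP => [Ea|nEa].
  (* By [on_track], the right end of a group is visited only while this group is the last one
     started, so the next group begins at [rep n]. *)
  have Eat : a = top n.
    apply/eqP; rewrite eqn_leq started_le_top // br ?mem_head // Ea; exact: gmax_brk.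
  case: (ltnP n (size reps)) => [lt|ge].
    right; have [ar _ _] := ot lt.
    have [|c cr gc|H -> ->] := @next_group_some C (rep n) CC (rep_mem lt).
    - by rewrite -Ea.
    - rewrite leqNgt; apply/negP => cu; move: cu; rewrite -mem_take_reps // => /gmax_ge.
      have := rep_lt_cmax cr; lia.
    by rewrite nsr //; split; auto.
  rewrite next_group_none; last first.
    by move=> c cr; rewrite -Ea Eat all_started //;
      apply/(leq_trans (ltnW (rep_lt_cmax cr)))/gmax_ge.
  have := first_unstartedP G (rev (take n reps)).
  case: first_unstarted => [c [/(mem_group GG) cr]|_]; last by left.
  by rewrite mem_rev all_started // cr.
(* At [top n] every cycle that begins no further right is started and ends by [top n]; such a cell
   satisfies [brk] and would be the right end of its group. *)
have nat : n < size reps -> a != top n.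
  move=> lt; apply/eqP => Eat; apply: nEa; apply/esym; apply: brk_gmax => // c cr ca.
  have [ar _ _] := ot lt; rewrite Eat; apply: gmax_ge; rewrite mem_take_reps //.
  exact: leq_ltn_trans ca ar.
have := first_unstartedP G (rev (take n reps)).
case: first_unstarted => [c [cGr]|sub]; last first.
  left; split=> // lt; split; last exact: nat.
  (* If [rep n <= g], then [rep n] lies between the minimum of the cycle of [g] and [g], hence in
     the same group, which has no unstarted cycle. *)
  rewrite ltnNge; apply/negP => ug.
  have uG : rep n \in G.
    apply: rep_in_group => //; first exact: rep_mem.
    have := gmin_le cG; have := cg lt; lia.
  by have := sub _ uG; rewrite mem_rev mem_take_reps ?rep_mem // ltnn.
rewrite mem_rev => ct cmn; have cr := mem_group GG cGr.
have lt : n < size reps by rewrite ltnNge; apply: contra ct => /all_started->.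
move: ct; rewrite mem_take_reps // -leqNgt => uc.
have uG : rep n \in G.
  apply: rep_in_group => //; first exact: rep_mem.
  have := gmin_le cG; have := cg lt; have := gmax_ge cGr; have := rep_lt_cmax cr; lia.
have Ec : c = rep n.
  apply/eqP; rewrite eqn_leq uc andbT; apply: cmn => //.
  by rewrite mem_rev mem_take_reps ?rep_mem // ltnn.
have [ar _ _] := ot lt; rewrite /strictly_between Ec ar /=.
case: ifP => [h|/negbT h]; first by right; rewrite nsr //; split=> //; left; lia.
left; split=> // _; split; last exact: nat.
have : g != rep n.
  by apply/eqP => E; have := cg lt; rewrite E reps_cmin ?rep_mem // ltnn.
lia.
Qed.

(** * Remaining pick-n-swaps and remaining rightward crossings *)

Definition misplaced s := count (fun q => cont s q != Some q) ntcells.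

(** The cell [rep n] contained a foreign item and receives nothing or an item bound for an already
    started cell, so it stays misplaced. *)
Lemma misplaced_start n s L : route n s L -> n < size reps ->
  misplaced (pns s (rep n)) = misplaced s.
Proof.
move=> [[_ hs _ _] [aL un _]] ns; apply: eq_count => q.
rewrite cont_pns; case: (q =P rep n) => // ->; have ur := rep_mem ns.
have nst : ~~ started n (rep n).
  by rewrite /started reps_cmin // mem_take_reps // ltnn andbF.
have /andP[Hu ne] := reps_nontriv ur; rewrite un // (inj_eq Some_inj) ne hs.
case: (L) aL => //= x L' /andP[sx _]; apply/eqP => -[E].
by rewrite -E sx in nst.
Qed.

Lemma misplaced_goal n s g L : route n s (g :: L) ->
  misplaced s = (misplaced (pns s g)).+1.
Proof.
move=> [[_ hs /= /andP[/eqP cg _] /andP[gL _]] [/= /andP[/andP[ng _] _] _ _]].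
have gN : g \in ntcells by rewrite mem_ntcells.
rewrite /misplaced !(permP (perm_to_rem gN)) /= cont_pns eqxx hs eqxx add0n cg.
have -> : ohead L != Some g.
  by case: (L) gL => //= x L'; rewrite inE (inj_eq Some_inj) eq_sym; case: eqP.
rewrite add1n; congr _.+1; apply: eq_in_count => q.
by rewrite mem_rem_uniq ?ntcells_uniq // inE => /andP[/negPf qg _]; rewrite cont_pns qg.
Qed.

(** The part of [need k] not yet spent: pending items, plus the single passage through a gap edge as
    long as no cycle beyond it has been started. *)
Definition budget k n s a := pending k s a +
  [&& crossings k == 0, has (fun c => k < c) reps & ~~ has (fun c => k < c) (take n reps)].

(** A cell at or left of [k] is fixed or belongs to a started cycle, which ends by [top n]; no goal
    lies beyond [k]. *)
Lemma crossings_gap n k : n < size reps -> top n <= k < rep n -> crossings k = 0.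
Proof.
move=> ns /andP[tk ku]; rewrite /crossings /pending /= andbF addn0.
apply: big1_seq => q /=; rewrite mem_iota => Hq.
have {}Hq : 1 <= q <= m by lia.
rewrite Hq /=; case: (leqP q k) => //= qk.
case: (boolP (nontriv pi q)) => [nq|]; last first.
  by rewrite /nontriv Hq negbK /= => /eqP->; rewrite ltnNge qk.
have cq : cmin pi q \in take n reps.
  by rewrite mem_take_reps ?cmin_rep // (leq_ltn_trans (cmin_leq Hq)) // (leq_ltn_trans qk).
have := gmax_ge cq; rewrite cmax_cmin // => ct.
by rewrite ltnNge (leq_trans (cmax_ge (pf_orb Hq))) // (leq_trans ct).
Qed.

Lemma budget_goal k n s a g : hold s = Some g -> 1 <= g <= m ->
  (a <= k < g) + budget k n (pns s g) g <= budget k n s a.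
Proof.
by move=> hs Hg; rewrite /budget pending_pns // /pending hs /=; lia.
Qed.

Lemma has_takeS n k : n < size reps ->
  has (fun c => k < c) (take n.+1 reps) = (k < rep n) || has (fun c => k < c) (take n reps).
Proof. by move=> ns; rewrite take_repsS // has_rcons. Qed.

(** The held item pays for the edges up to [rep n]; parked there, it stays pending for those from
    [rep n] to [g]. *)
Lemma budget_pass k n s a g : n < size reps -> hold s = Some g -> a < rep n < g ->
  (a <= k < rep n) + budget k n.+1 (pns s (rep n)) (rep n) <= budget k n s a.
Proof.
move=> ns hs ag; have Hu := nontriv_range (reps_nontriv (rep_mem ns)).
rewrite /budget pending_pns // /pending hs /= has_takeS // negb_or.
by case: (has _ (take n reps)); rewrite /= ?andbF; lia.
Qed.

(** The held item cannot pay beyond [top n], but the edges crossed are gap edges whose reserved unit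
    is still unspent. The condition on [a] admits both [a = top n] and the first move, where [a] is
    1 and [top 0] is 0. *)
Lemma budget_jump k n s a : n < size reps -> ~~ itemgt (top n) (hold s) ->
  (a <= k -> top n <= k) -> top n < rep n ->
  (a <= k < rep n) + budget k n.+1 (pns s (rep n)) (rep n) <= budget k n s a.
Proof.
move=> ns hs ak tu; have ur := rep_mem ns; have Hu := nontriv_range (reps_nontriv ur).
rewrite /budget pending_pns // /pending has_takeS // negb_or.
have hk : top n <= k -> itemgt k (hold s) = false.
  by move: hs; case: (hold s) => //= g; lia.
case: (leqP a k) => /= [/ak tk|ka]; last first.
  case: (leqP (rep n) k) => ruk /=; last by rewrite ?andbF; lia.
  by rewrite hk ?andbF //; lia.
rewrite (hk tk) !andbF !addn0; case: (ltnP k (rep n)) => //= ku.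
have gap : top n <= k < rep n by rewrite tk.
rewrite (crossings_gap ns gap) eqxx /=.
have -> : has (fun c => k < c) reps by apply/hasP; exists (rep n).
have -> : has (fun c => k < c) (take n reps) = false.
  apply/hasP => -[c ct kc]; have := gmax_ge ct; have := rep_lt_cmax (take_reps_sub ct); lia.
by rewrite andbF addn0 addnC.
Qed.

Definition solves s a P N (B : nat -> nat) := [/\ all (fun p => 1 <= p <= m) P, size P = N,
  hold (foldl pns s P) = None, forall q, 1 <= q <= m -> cont (foldl pns s P) q = Some q
  & forall k, rcross k a P <= B k].

Lemma solves_cons s a p P N B B' : 1 <= p <= m -> solves (pns s p) p P N B' ->
  (forall k, (a <= k < p) + B' k <= B k) -> solves s a (p :: P) N.+1 B.
Proof.
move=> Hp [aP sP hP cP rP] h; split; rewrite /= ?Hp ?sP // => k.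
by rewrite rcross_cons (leq_trans _ (h k)) // leq_add2l.
Qed.

Lemma route_done n s : route n s [::] -> size reps <= n ->
  forall q, 1 <= q <= m -> cont s q = Some q.
Proof.
move=> [_ [_ un co]] ge q Hq; case: (boolP (nontriv pi q)) => nq.
  by apply: co => //; rewrite /started nq take_oversize // cmin_rep.
rewrite un //; last by rewrite /started (negPf nq).
by move: nq; rewrite /nontriv Hq negbK => /eqP->.
Qed.

(** Starting a cycle lowers the number of unstarted cycles by one, delivering lowers [misplaced] by
    one. Their sum is thus the exact number of remaining operations, and the fuel never runs out. *)
Lemma arun_solves fuel n a s L : route n s L -> on_track n a L ->
  (size reps - n) + misplaced s < fuel ->
  solves s a (arun pi fuel a s (rev (take n reps)))
    ((size reps - n) + misplaced s) (fun k => budget k n s a).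
Proof.
elim: fuel n a s L => // fuel IH n a s [|g L] ro ot lf.
  have [[ns hs _ _] _] := ro; have [_ _ ot'] := ot.
  have ge : size reps <= n.
    rewrite leqNgt; apply/negP => lt; have [_ _ /= r0] := ot' lt.
    have : rep 0 \in reps by apply: rep_mem; apply: leq_ltn_trans lt.
    by rewrite -r0 mem_reps /nontriv.
  have -> : arun pi fuel.+1 a s (rev (take n reps)) = [::].
    rewrite /= /anext hs; have := first_unstartedP reps (rev (take n reps)).
    by case: first_unstarted => // c [cr]; rewrite mem_rev take_oversize // cr.
  have done_ := route_done ro ge.
  split=> //=; apply/esym/eqP; rewrite addn_eq0 subn_eq0 ge /=.
  rewrite -leqn0 leqNgt -has_count; apply/hasP => -[q].
  by rewrite mem_ntcells => /nontriv_range/done_->; rewrite eqxx.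
have [[ns hs _ _] [/= /andP[sg _] _ _]] := ro; have Hg := started_range sg.
case: (anext_held ro ot) => [[-> h]|[lt -> h]].
  rewrite (misplaced_goal ro) addnS; apply: solves_cons => //.
    apply: IH; [exact: route_goal ro | exact: on_track_goal ro ot h|].
    by move: lf; rewrite (misplaced_goal ro) addnS ltnS.
  by move=> k; apply: budget_goal.
have [l [ro' ml]] := route_start ro lt.
have Hu := nontriv_range (reps_nontriv (rep_mem lt)).
have mis := misplaced_start ro lt.
have -> : size reps - n + misplaced s = (size reps - n.+1 + misplaced (pns s (rep n))).+1.
  by rewrite mis -addSn subnSK.
apply: solves_cons => //.
  apply: IH; [exact: ro'| |by rewrite mis; lia].
  apply: (on_track_start ro lt ml (a := a)); right; split=> //.
  by case: h => [h|]; [left; exists g; rewrite ?mem_head | right].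
move=> k; case: h => [h|at_]; first exact: budget_pass hs h.
have [_ _ /(_ lt)[ar _ _]] := ot.
apply: budget_jump => //; rewrite -?at_ //= hs /= -leqNgt at_; exact: started_le_top.
Qed.

(** The first move is treated separately: [on_track] requires the end-effector to stand in a started
    cycle, which fails at the outset. The fuel suffices because both summands of the length are at
    most [m]. *)
Lemma OptPlanLOR_solves :
  solves (init pi) 1 (OptPlanLOR pi) (size ntcells + size reps) need.
Proof.
have mis : misplaced (init pi) = size ntcells.
  apply/eqP; rewrite -all_count; apply/allP => q; rewrite mem_ntcells => /andP[Hq ne].
  by rewrite cont_init // (inj_eq Some_inj).
have szN : size ntcells <= m by rewrite size_filter (leq_trans (count_size _ _)) ?size_iota.
have szR : size reps <= m by rewrite size_filter (leq_trans (count_size _ _)) ?size_iota.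
have := first_unstartedP reps [::]; rewrite /OptPlanLOR addn1 /= /anext /=.
case: first_unstarted => [c [cr _ cmn]|sub].
  have lt : 0 < size reps by case: (reps) cr.
  have Ec : c = rep 0.
    apply/eqP; rewrite eqn_leq cmn ?rep_mem //=.
    by rewrite leqNgt -mem_take_reps // take0.
  have [l [ro' ml]] := route_start route_init lt.
  have Hu := nontriv_range (reps_nontriv (rep_mem lt)).
  have -> : size ntcells + size reps = (size reps - 1 + misplaced (pns (init pi) (rep 0))).+1.
    by rewrite (misplaced_start route_init) // mis; lia.
  rewrite Ec; apply: solves_cons => //.
    have -> : [:: rep 0] = rev (take 1 reps) by rewrite take_repsS // take0.
    apply: arun_solves ro' _ _; first by apply: (on_track_start route_init lt ml (a := 1)); left.
    by rewrite (misplaced_start route_init) // mis; lia.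
  move=> k; apply: leq_trans (@budget_jump k 0 (init pi) 1 lt _ _ _) _ => //.
  - by rewrite take0.
  - by rewrite take0; case/andP: Hu.
  by rewrite /budget take0 /= andbT.
(* Without non-trivial cycles the plan is empty and every item is already home. *)
have r0 : reps = [::] by case: (reps) sub => // c r /(_ c); rewrite mem_head => /(_ isT).
have done_ := route_done route_init; rewrite r0 in done_.
split=> //; last by move=> q Hq; apply: done_.
rewrite r0 addn0 -mis; apply/esym/eqP; rewrite -leqn0 leqNgt -has_count; apply/hasP => -[q].
by rewrite mem_ntcells => /nontriv_range/done_->; rewrite ?eqxx.
Qed.

End Instance.

Theorem theorem1 (pi : seq nat) (Hpi : is_instance pi) :
  valid pi (OptPlanLOR pi) /\
  (forall P : seq nat, valid pi P -> nswaps (OptPlanLOR pi) <= nswaps P) /\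
  (forall P : seq nat, valid pi P -> nswaps P = nswaps (OptPlanLOR pi) ->
     travel (OptPlanLOR pi) <= travel P).
Proof.
have [aP sP hP cP rP] := OptPlanLOR_solves Hpi.
split; first by [].
split=> P vP; first by rewrite /nswaps sP; exact: swaps_lower_bound.
move=> _; have [aP' _] := vP; rewrite !(@travel_rcross pi) //.
(* The comparison is made edge by edge, with [need k] between the two crossing numbers. *)
rewrite big_nat [X in _ <= X]big_nat; apply: leq_sum => k /andP[k0 _].
rewrite leq_mul2l /=; apply: leq_trans (rP k) _; exact: rcross_lower_bound.
Qed.
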